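(* Let $X$ be a set, $\mathcal{H}$ a Hilbert space and $K:X\times X\to\mathcal{L}(\mathcal{H})$ a kernel. The kernel $K$ is decomposable if and only if there is a Hilbert space $\mathcal{K}$, a mapping $V:X\to\mathcal{L}(\mathcal{H},\mathcal{K})$, and a contraction $U$ on $\mathcal{K}$ such that $K(x,y)=V(x)^*UV(y)$ for all $x,y\in X$, and the set $\{V(x)h\mid x\in X,\ h\in\mathcal{H}\}$ is total in $\mathcal{K}$.
   Context: $\mathcal{L}(\mathcal{H},\mathcal{K})$ denotes bounded linear operators and $\mathcal{L}(\mathcal{H})=\mathcal{L}(\mathcal{H},\mathcal{H})$; a contraction is a bounded operator of norm at most $1$; a set is total if its linear span is dense. For a kernel $K:X\times X\to\mathcal{L}(\mathcal{H})$ the adjoint kernel is $K^*(x,y)=K(y,x)^*$, and $K$ is hermitian if $K^*=K$. A hermitian kernel $L:X\times X\to\mathcal{L}(\mathcal{E})$ ($\mathcal{E}$ a Hilbert space) is positive definite if $\sum_{x,y\in X}\langle L(x,y)f(y),f(x)\rangle\ge0$ for all finitely supported $f:X\to\mathcal{E}$. A kernel $K:X\times X\to\mathcal{L}(\mathcal{H})$ is called decomposable if there exist two positive definite kernels $L_1,L_2:X\times X\to\mathcal{L}(\mathcal{H})$ such that the kernel $\begin{bmatrix} L_1 & K \\ K^* & L_2 \end{bmatrix}$, defined on $X\times X$ with values in $\mathcal{L}(\mathcal{H}\oplus\mathcal{H})$, is positive definite. *)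

(* Defs.v *)
From HB Require Import structures.
From mathcomp Require Import all_boot all_order all_algebra.
From mathcomp Require Import complex.
From mathcomp Require Import all_classical all_reals.
From mathcomp Require Import topology normedtype.

Set Implicit Arguments.
Unset Strict Implicit.
Unset Printing Implicit Defensive.

Import Order.TTheory GRing.Theory Num.Theory.
Import numFieldNormedType.Exports.

Local Open Scope classical_set_scope.
Local Open Scope complex_scope.
Local Open Scope ring_scope.

(* Hilbert spaces are complex, over R[i]. As for every [{dot _ for _}], the
   inner product is linear in its first argument and conjugate-linear in its
   second one. *)
HB.mixin Record NormedModule_isHilbert (R : realType) H
    & NormedModule R[i] H := {
  inner : {dot H for Num.conj};
  inner_norm : forall x : H, inner x x = `|x| ^+ 2
}.

#[short(type="hilbertType")]
HB.structure Definition Hilbert (R : realType) :=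
  {H of CompleteNormedModule R[i] H & NormedModule_isHilbert R H}.

Section dot_triangle.
Variables (C : numClosedFieldType) (U : lmodType C).
Variable form : {dot U for Num.conj}.

Lemma dot_CauchySchwarz u v :
  `|form u v| <= sqrtC (form u u) * sqrtC (form v v).
Proof.
have [->|v0] := eqVneq v 0.
  by rewrite linear0r normr0 mulr_ge0// sqrt_dnorm_ge0.
pose a := form u v / form v v; pose w := u - a *: v.
have ow : form w v = 0.
  by rewrite linearBl/= linearZl_LR/= divfK ?subrr// dnorm_eq0.
have uE : u = w + a *: v by rewrite subrK.
have := dnorm_ge0 form w.
have -> : form w w = form u u - `|a| ^+ 2 * form v v.
  have ow' : form w (a *: v) = 0 by rewrite linearZr_LR/= ow mulr0.
  by rewrite {1 2}uE dnormD ow' conjC0 !addr0 dnormZ addrK.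
rewrite subr_ge0 normrM normfV (ger0_norm (dnorm_ge0 _ v)) => le_uv.
rewrite -(sqrCK (normr_ge0 (form u v))) -rootCMl ?dnorm_ge0//.
rewrite ler_sqrtC ?nnegrE ?exprn_ge0 ?mulr_ge0 ?dnorm_ge0//.
rewrite -ler_pdivrMr ?dnorm_gt0//; apply: le_trans le_uv.
rewrite expr_div_n (expr2 (form v v)) invfM [_ * (_ / _)]mulrA.
by rewrite mulfVK ?dnorm_eq0.
Qed.

Lemma dot_triangle u v :
  sqrtC (form (u + v) (u + v)) <= sqrtC (form u u) + sqrtC (form v v).
Proof.
rewrite -ler_sqr ?nnegrE ?addr_ge0 ?sqrt_dnorm_ge0//.
rewrite sqrtCK sqrrD !sqrtCK dnormD addrAC lerD2r lerD2l.
rewrite (le_trans (real_ler_norm _))//.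
  by rewrite CrealE rmorphD /= conjCK addrC.
rewrite (le_trans (ler_normD _ _))// norm_conjC -mulr2n lerMn2r/=.
exact: dot_CauchySchwarz.
Qed.

End dot_triangle.

(* Equips an inner product space with its norm [sqrtC (form x x)], the induced
   topology and [inner := form]; completeness is to be added separately. *)
HB.factory Record Lmodule_isHilbert (R : realType) H & GRing.Lmodule R[i] H := {
  form : {dot H for Num.conj}
}.

HB.builders Context R H & Lmodule_isHilbert R H.

Let normZ (l : R[i]) (x : H) :
  sqrtC (form (l *: x) (l *: x)) = `|l| * sqrtC (form x x).
Proof.
by rewrite dnormZ rootCMl ?exprn_ge0// sqrCK.
Qed.

Let norm0 (x : H) : sqrtC (form x x) = 0 -> x = 0.
Proof. by move/eqP; rewrite sqrt_dnorm_eq0 => /eqP. Qed.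

HB.instance Definition _ :=
  @Lmodule_isNormed.Build R[i] H _ (dot_triangle form) normZ norm0.

HB.instance Definition _ :=
  @NormedModule_isHilbert.Build R H form (fun x => esym (sqrtCK _)).

HB.end.

(* The Hilbert space direct sum. The alias keeps it apart from the product
   [H1 * H2], whose canonical norm is the maximum of the two norms. *)
Definition dsum (R : realType) (H1 H2 : hilbertType R) : Type := (H1 * H2)%type.

Section dsum.
Variables (R : realType) (H1 H2 : hilbertType R).

HB.instance Definition _ := GRing.Lmodule.copy (dsum H1 H2) (H1 * H2)%type.

Definition dsum_form (u v : dsum H1 H2) : R[i] :=
  inner u.1 v.1 + inner u.2 v.2.

Let dsum_formP :
  bilinear_for *%R (Num.conj \; *%R : R[i] -> R[i] -> R[i]) dsum_form.
Proof.
split=> w a u v; rewrite /dsum_form/=.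
  by rewrite !linearPl/= mulrDr addrACA.
by rewrite !linearPr/= mulrDr addrACA.
Qed.

HB.instance Definition _ :=
  @bilinear_isBilinear.Build _ _ _ _ _ _ dsum_form dsum_formP.

Let dsum_form_hermitian (u v : dsum H1 H2) :
  dsum_form u v = (-1) ^+ false * Num.conj (dsum_form v u).
Proof.
rewrite mul1r rmorphD/= /dsum_form !(hermC _ v.1, hermC _ v.2)/=.
by rewrite !mul1r !conjCK.
Qed.

HB.instance Definition _ := @isHermitianSesquilinear.Build
  R[i] (dsum H1 H2) false Num.conj dsum_form dsum_form_hermitian.

Let dsum_form_gt0 (u : dsum H1 H2) : u != 0 -> 0 < dsum_form u u.
Proof.
move=> u0; rewrite lt_def addr_ge0 ?dnorm_ge0// andbT.
apply: contra u0; rewrite paddr_eq0 ?dnorm_ge0// !dnorm_eq0.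
by case: u => u1 u2 /andP[/= /eqP-> /eqP->].
Qed.

HB.instance Definition _ :=
  @isDotProduct.Build R[i] (dsum H1 H2) dsum_form dsum_form_gt0.

HB.instance Definition _ := @Lmodule_isHilbert.Build R (dsum H1 H2) dsum_form.

Lemma dsum_normE (u : dsum H1 H2) : `|u| ^+ 2 = `|u.1| ^+ 2 + `|u.2| ^+ 2.
Proof.
have -> : `|u| = sqrtC (dsum_form u u) by [].
by rewrite sqrtCK -!inner_norm.
Qed.

Lemma dsum_norm_fst (u : dsum H1 H2) : `|u.1| <= `|u|.
Proof.
by rewrite -ler_sqr ?nnegrE// dsum_normE lerDl exprn_ge0.
Qed.

Lemma dsum_norm_snd (u : dsum H1 H2) : `|u.2| <= `|u|.
Proof.
by rewrite -ler_sqr ?nnegrE// dsum_normE lerDr exprn_ge0.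
Qed.

Lemma dsum_norm_le (u : dsum H1 H2) : `|u| <= `|u.1| + `|u.2|.
Proof.
rewrite -ler_sqr ?nnegrE ?addr_ge0// dsum_normE sqrrD lerD2r lerDl.
by rewrite mulrn_wge0// mulr_ge0.
Qed.

Let dsum_complete (F : set_system (dsum H1 H2)) :
  ProperFilter F -> cauchy F -> cvg F.
Proof.
move=> FF /cauchy_ballP Fc.
have cvg1 : cvg ((fun u : dsum H1 H2 => u.1) @ F).
  apply/cauchy_cvgP/cauchy_ballP => e e0; near_simpl.
  have := Fc e e0; apply: filterS => -[u v] /=.
  by rewrite -!ball_normE/=; apply: le_lt_trans; exact: dsum_norm_fst (u - v).
have cvg2 : cvg ((fun u : dsum H1 H2 => u.2) @ F).
  apply/cauchy_cvgP/cauchy_ballP => e e0; near_simpl.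
  have := Fc e e0; apply: filterS => -[u v] /=.
  by rewrite -!ball_normE/=; apply: le_lt_trans; exact: dsum_norm_snd (u - v).
pose l : dsum H1 H2 := (lim ((fun u : dsum H1 H2 => u.1) @ F),
                        lim ((fun u : dsum H1 H2 => u.2) @ F)).
apply/cvg_ex; exists l; apply/cvgrPdist_lt => e e0.
have e20 : 0 < e / 2 by rewrite divr_gt0.
move/cvgrPdist_lt : cvg1 => /(_ _ e20); move/cvgrPdist_lt : cvg2 => /(_ _ e20).
apply: filterS2 => u u2 u1; apply: le_lt_trans (dsum_norm_le (l - u)) _.
by rewrite [ltRHS]splitr ltrD.
Qed.

HB.instance Definition _ :=
  @Uniform_isComplete.Build (dsum H1 H2) dsum_complete.

End dsum.

HB.saturate dsum.

HB.mixin Record isBoundedOp (R : realType) (H K : hilbertType R)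
    (T : H -> K) := {
  bounded_op_subproof : exists M : R, forall x, `|T x| <= M%:C * `|x|
}.

#[short(type="bounded_op")]
HB.structure Definition BoundedOp (R : realType) (H K : hilbertType R) :=
  {T of @GRing.Linear R[i] H K *:%R T & isBoundedOp R H K T}.

Lemma bounded_op_ge0 (R : realType) (H K : hilbertType R)
    (T : bounded_op H K) :
  exists2 M : R[i], 0 <= M & forall x, `|T x| <= M * `|x|.
Proof.
have [M TM] := @bounded_op_subproof R H K T.
exists `|M%:C| => // x; rewrite (le_trans (TM x))// ler_wpM2r// real_ler_norm//.
by rewrite complex_real.
Qed.

HB.instance Definition _ (R : realType) (H K : hilbertType R) :=
  gen_eqMixin (bounded_op H K).
HB.instance Definition _ (R : realType) (H K : hilbertType R) :=
  gen_choiceMixin (bounded_op H K).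

Section operators.
Variable R : realType.
Implicit Types H K : hilbertType R.

Lemma bounded_op0 H K :
  exists M : R, forall x : H, `|(\0 : H -> K) x| <= M%:C * `|x|.
Proof. by exists 0 => x; rewrite normr0 mul0r. Qed.

HB.instance Definition _ H K :=
  @isBoundedOp.Build R H K \0 (bounded_op0 H K).

Definition opnorm H K (T : bounded_op H K) : R :=
  sup [set complex.Re `|T x| | x in [set x : H | `|x| <= 1]].

Definition contraction_op H K (T : bounded_op H K) := opnorm T <= 1.

Definition is_adjoint H K (T : bounded_op H K) (S : bounded_op K H) :=
  forall x y, inner (T x) y = inner x (S y).

(* The adjoint exists by the Riesz representation theorem and is unique, so
   that the default value [\0] is never used. *)
Definition adjoint H K (T : bounded_op H K) : bounded_op K H :=
  xget (\0 : bounded_op K H) [set S | is_adjoint T S].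

Definition linspan H (A : set H) : set H :=
  [set v | exists n (a : 'I_n -> R[i]) (s : 'I_n -> H),
    (forall i, A (s i)) /\ v = \sum_(i < n) a i *: s i].

Definition total_set H (A : set H) := dense (linspan A).

End operators.

Section block_op.
Variables (R : realType) (H1 H2 K1 K2 : hilbertType R).
Variables (A : bounded_op H1 K1) (B : bounded_op H2 K1).
Variables (C : bounded_op H1 K2) (D : bounded_op H2 K2).

Definition block_op (u : dsum H1 H2) : dsum K1 K2 :=
  (A u.1 + B u.2, C u.1 + D u.2).

Let block_op_linear : linear block_op.
Proof.
move=> a u v; rewrite /block_op/= !linearP/=.
by rewrite addrACA -scalerDr [X in (_, X)]addrACA -scalerDr.
Qed.

HB.instance Definition _ :=
  GRing.isLinear.Build R[i] (dsum H1 H2) (dsum K1 K2) *:%R block_op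
    block_op_linear.

Let block_op_bounded : exists M : R, forall u, `|block_op u| <= M%:C * `|u|.
Proof.
have [MA MA0 leA] := bounded_op_ge0 A; have [MB MB0 leB] := bounded_op_ge0 B.
have [MC MC0 leC] := bounded_op_ge0 C; have [MD MD0 leD] := bounded_op_ge0 D.
have M0 : 0 <= MA + MB + (MC + MD) by rewrite !addr_ge0.
exists (complex.Re (MA + MB + (MC + MD))) => u.
rewrite RRe_real ?ger0_real//; apply: le_trans (dsum_norm_le _) _.
have le_fst M : 0 <= M -> M * `|u.1| <= M * `|u|.
  by move=> ?; rewrite ler_wpM2l// dsum_norm_fst.
have le_snd M : 0 <= M -> M * `|u.2| <= M * `|u|.
  by move=> ?; rewrite ler_wpM2l// dsum_norm_snd.
rewrite !mulrDl lerD// (le_trans (ler_normD _ _))// lerD//.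
- exact: le_trans (leA _) (le_fst _ _).
- exact: le_trans (leB _) (le_snd _ _).
- exact: le_trans (leC _) (le_fst _ _).
- exact: le_trans (leD _) (le_snd _ _).
Qed.

HB.instance Definition _ :=
  @isBoundedOp.Build R (dsum H1 H2) (dsum K1 K2) block_op block_op_bounded.

End block_op.

Section kernels.
Variables (R : realType) (X : Type).
Implicit Types H : hilbertType R.

Definition kernel H := X -> X -> bounded_op H H.

Definition adjoint_kernel H (K : kernel H) : kernel H :=
  fun x y => adjoint (K y x).

Definition hermitian_kernel H (K : kernel H) :=
  forall x y, adjoint_kernel K x y =1 K x y.

(* [{classic X}] is [X] with the choiceType structure that finite-support sums
   require. *)
Definition positive_definite H (L : kernel H) :=
  hermitian_kernel L /\
  forall f : {classic X} -> H, finite_set [set x | f x != 0] ->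
    0 <= \sum_(x \in [set: {classic X}]) \sum_(y \in [set: {classic X}])
           inner (L x y (f y)) (f x).

Definition block_kernel H (A B C D : kernel H) : kernel (dsum H H) :=
  fun x y => block_op (A x y) (B x y) (C x y) (D x y).

Definition decomposable H (K : kernel H) :=
  exists L1 L2 : kernel H,
    [/\ positive_definite L1, positive_definite L2 &
        positive_definite (block_kernel L1 K (adjoint_kernel K) L2)].

End kernels.

(* Main.v *)
From HB Require Import structures.
Require Import Defs.
From mathcomp Require Import all_boot all_order all_algebra.
From mathcomp Require Import complex ring lra.
From mathcomp Require Import all_classical all_reals.
From mathcomp Require Import topology normedtype.

Set Implicit Arguments.
Unset Strict Implicit.
Unset Printing Implicit Defensive.

Import Order.TTheory GRing.Theory Num.Theory.
Import numFieldNormedType.Exports.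

Local Open Scope classical_set_scope.
Local Open Scope complex_scope.
Local Open Scope ring_scope.

(** Write [l1], [l2] and [k] for the sesquilinear forms that the kernels [L1],
    [L2] and [K] define on the finitely supported functions from [X] to [H].

    The block kernel is positive definite exactly when the quadratic form
    l1(g, g) + 2 Re k(f, g) + l2(f, f) is nonnegative, that is, when [k]
    satisfies the Cauchy-Schwarz inequality
    |k(f, g)|^2 <= l2(f, f) l1(g, g) ([block_CauchySchwarz]). In particular [k]
    is bounded by 1 for the seminorm of the semi-inner product s = l1 + l2, and
    a sesquilinear form with this property is <U f, g> for a contraction [U] on
    the Hilbert space completion of [s] ([contraction_of_form]). Sending h to
    the class of the function with value h at x and 0 elsewhere gives an
    operator V(x); K(x, y) = V(x)* U V(y) is the identity <U f, g> = k(f, g) for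
    two such functions, which span a dense subspace
    ([decomposable_factorization]).

    Conversely, if K(x, y) = V(x)* U V(y), take L1(x, y) = L2(x, y) =
    V(x)* V(y). At a pair (f1, f2) of finitely supported functions, with
    a = sum of V(x) f1(x) and b = sum of V(x) f2(x), the quadratic form of the
    block kernel is |a + U b|^2 + (|b|^2 - |U b|^2), nonnegative because [U] is a
    contraction ([factorization_decomposable]).

    Two general facts are proved on the way, both from one minimization
    argument: in a semi-inner product space, a bounded conjugate-linear
    functional [phi] is within any e > 0 of a functional s(u, .), where u nearly
    minimizes s(u, u) - 2 Re phi(u) ([approximate_Riesz]). In a Hilbert space,
    letting e tend to 0 gives the Riesz representation theorem and the existence
    of adjoints. In general it says that the space of all bounded
    conjugate-linear functionals is a completion of [s]: this is the model used
    here, in which vectors of seminorm 0 are identified without a quotient. *)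

(** * Real-valued estimates *)

Section real_estimates.
Variable R : realType.
Implicit Types a b c e x y M : R.

(** The Cauchy sequences below satisfy |x n - x m| <= M * (rate n + rate m), so
    that no modulus of convergence has to be carried around. *)
Definition rate (n : nat) : R := n.+1%:R^-1.

Lemma rate_gt0 n : 0 < rate n.
Proof. by rewrite invr_gt0. Qed.

Lemma rate_small e : 0 < e -> exists N, forall n, (N <= n)%N -> rate n < e.
Proof.
move=> e0; exists (Num.truncn e^-1) => n le_n.
rewrite /rate invf_plt ?posrE//; apply: lt_le_trans (truncnS_gt _) _.
by rewrite ler_nat.
Qed.

Lemma le0_of_small x M : (forall e, 0 < e <= 1 -> x <= M * e) -> x <= 0.
Proof.
move=> xM; rewrite leNgt; apply/negP => x0.
have [M0|M0] := lerP M 0; first by have := xM 1; rewrite ltr01 lexx => /(_ isT); lra.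
have d0 : 0 < M *+ 2 + x by rewrite addr_gt0// mulrn_wgt0.
have e01 : 0 < x / (M *+ 2 + x) <= 1.
  by rewrite divr_gt0//= ler_pdivrMr// mul1r lerDr mulrn_wge0// ltW.
have := xM _ e01; rewrite mulrA ler_pdivlMr//; apply/negP; rewrite -ltNge.
by rewrite mulrC ltr_pM2l// mulr2n -addrA ltrDl addr_gt0.
Qed.

(** The nonpositive discriminant of t |-> a - 2 c t + c b t^2. The factor [c] in
    both coefficients is the form that completing a square in a complex space
    produces; it makes the conclusion linear in [c]. *)
Lemma discriminant a b c : 0 <= a -> 0 <= b ->
  (forall t : R, 0 <= a - t * c *+ 2 + t ^+ 2 * c * b) -> c <= a * b.
Proof.
move=> a0 b0 q; have [b_eq0|b_neq0] := eqVneq b 0; last first.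
  have {b_neq0}bp : 0 < b by rewrite lt_neqAle eq_sym b_neq0.
  have := q b^-1; have -> : a - b^-1 * c *+ 2 + b^-1 ^+ 2 * c * b = a - c / b.
    by field; rewrite gt_eqF.
  by rewrite subr_ge0 ler_pdivrMr.
rewrite b_eq0 mulr0 leNgt; apply/negP => c0.
(* for [b = 0] the quadratic is affine in [t], and this [t] makes it negative *)
have := q ((a + 1) / c).
have -> : (a + 1) / c * c = a + 1 by rewrite divfK// gt_eqF.
by rewrite b_eq0 mulr0; lra.
Qed.

(** The limit is the supremum of the lower bounds [x n - M * rate n]. *)
Lemma real_fast_cauchy (x : nat -> R) M : 0 <= M ->
  (forall n m, `|x n - x m| <= M * (rate n + rate m)) ->
  exists l, forall n, `|l - x n| <= M * rate n.
Proof.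
move=> M0 xM; pose A := range (fun n => x n - M * rate n).
have ubA n : ubound A (x n + M * rate n).
  move=> _ [m _ <-] /=.
  suff : x m - M * rate m <= x n + M * rate n by [].
  by have := xM m n; rewrite ler_norml => /andP[_]; lra.
have A0 : A !=set0 by exists (x 0%N - M * rate 0), 0%N.
exists (sup A) => n; rewrite ler_norml; apply/andP; split.
  suff : x n - M * rate n <= sup A by lra.
  by apply: ub_le_sup; [exists (x 0%N + M * rate 0); exact: ubA|exists n].
by rewrite lerBlDl; apply: ge_sup.
Qed.

End real_estimates.

Section real_norm.
Variable R : realType.
Local Notation C := R[i].
Local Notation rate := (@rate R).

(** Norms of complex spaces take values in the partially ordered [R[i]]; their
    real parts live in an ordered field, where estimates can be decided. *)
Definition nrm (V : normedZmodType C) (x : V) : R := complex.Re `|x|.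

Lemma nrmE (V : normedZmodType C) (x : V) : `|x| = (nrm x)%:C.
Proof. by rewrite /nrm RRe_real ?normr_real. Qed.

Section nrm_theory.
Variable V : normedZmodType C.
Implicit Types x y : V.

Lemma nrm_ge0 x : 0 <= nrm x.
Proof. by rewrite -ler0c -nrmE normr_ge0. Qed.

Lemma nrm_eq0 x : nrm x = 0 -> x = 0.
Proof. by move=> x0; apply: normr0_eq0; rewrite nrmE x0. Qed.

Lemma nrm0 : nrm (0 : V) = 0.
Proof. by rewrite /nrm normr0. Qed.

Lemma nrmN x : nrm (- x) = nrm x.
Proof. by rewrite /nrm normrN. Qed.

Lemma nrmB x y : nrm (x - y) = nrm (y - x).
Proof. by rewrite /nrm distrC. Qed.

Lemma nrmD x y : nrm (x + y) <= nrm x + nrm y.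
Proof. by rewrite -lecR rmorphD/= -!nrmE ler_normD. Qed.

Lemma nrm_trans (z x y : V) : nrm (x - y) <= nrm (x - z) + nrm (z - y).
Proof. by rewrite (le_trans _ (nrmD _ _))// addrA subrK. Qed.

Lemma nrm_le (x : V) (M : R) : (`|x| <= M%:C) = (nrm x <= M).
Proof. by rewrite nrmE lecR. Qed.

Lemma nrm_small x (M : R) : (forall e, 0 < e <= 1 -> nrm x <= M * e) -> x = 0.
Proof.
by move=> /le0_of_small x0; apply/nrm_eq0/eqP; rewrite eq_le x0 nrm_ge0.
Qed.

End nrm_theory.

Lemma nrmZ (V : normedModType C) (a : C) (x : V) : nrm (a *: x) = nrm a * nrm x.
Proof.
by apply: (@complexI R); rewrite rmorphM/= -!nrmE normrZ.
Qed.

Lemma nrmM (a b : C) : nrm (a * b) = nrm a * nrm b.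
Proof. by apply: (@complexI R); rewrite rmorphM/= -!nrmE normrM. Qed.

Lemma nrm_conj (a : C) : nrm (Num.conj a) = nrm a.
Proof. by rewrite /nrm norm_conjC. Qed.

Lemma mul_conj (a : C) : a * Num.conj a = (nrm a ^+ 2)%:C.
Proof. by rewrite -normCK nrmE rmorphXn. Qed.

Lemma Re_norm_le_nrm (a : C) : `|complex.Re a| <= nrm a.
Proof. by rewrite -lecR -nrmE normc_ge_Re. Qed.

Lemma Re_le_nrm (a : C) : complex.Re a <= nrm a.
Proof. exact: le_trans (ler_norm _) (Re_norm_le_nrm a). Qed.

Lemma nrm_sqr (a : C) : nrm a ^+ 2 = complex.Re a ^+ 2 + complex.Im a ^+ 2.
Proof. by apply: (@complexI R); rewrite add_Re2_Im2 nrmE rmorphXn. Qed.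

Lemma nrm_le_ReIm (a : C) : nrm a <= `|complex.Re a| + `|complex.Im a|.
Proof.
rewrite -ler_sqr ?nnegrE ?nrm_ge0 ?addr_ge0// nrm_sqr sqrrD !real_normK ?num_real//.
by rewrite lerD2r lerDl mulrn_wge0// mulr_ge0.
Qed.

Lemma Im_le_nrm (a : C) : `|complex.Im a| <= nrm a.
Proof.
rewrite -ler_sqr ?nnegrE ?nrm_ge0// nrm_sqr real_normK ?num_real//.
by rewrite lerDr sqr_ge0.
Qed.

Lemma ReD (a b : C) : complex.Re (a + b) = complex.Re a + complex.Re b.
Proof. by case: a; case: b. Qed.

Lemma ReB (a b : C) : complex.Re (a - b) = complex.Re a - complex.Re b.
Proof. by case: a; case: b. Qed.

Lemma ge0_ReE (a : C) : 0 <= a -> a = (complex.Re a)%:C.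
Proof. by move=> a0; rewrite RRe_real// ger0_real. Qed.

Lemma Re_ge0 (a : C) : 0 <= a -> 0 <= complex.Re a.
Proof. by rewrite lecE => /andP[]. Qed.

Lemma conj_real (a : R) : Num.conj a%:C = a%:C.
Proof. by apply/CrealP; rewrite complex_real. Qed.

Lemma conj_complexE (x y : R) : Num.conj (x +i* y : C) = x -i* y.
Proof.
by apply/eqP; rewrite eq_complex; apply/andP; split; apply/eqP/(@complexI R);
  rewrite ?(complexRe, complexIm) ?Re_conj ?Im_conj -?(complexRe, complexIm) ?rmorphN.
Qed.

Lemma complex_fast_cauchy (z : nat -> C) (M : R) : 0 <= M ->
  (forall n m, nrm (z n - z m) <= M * (rate n + rate m)) ->
  exists l, forall n, nrm (l - z n) <= M *+ 2 * rate n.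
Proof.
move=> M0 zM.
have [||r rP] := @real_fast_cauchy R (fun n => complex.Re (z n)) M => //.
  by move=> n m; rewrite -ReB; exact: le_trans (Re_norm_le_nrm _) (zM n m).
have [||i iP] := @real_fast_cauchy R (fun n => complex.Im (z n)) M => //.
  move=> n m; apply: le_trans (zM n m); apply: le_trans (Im_le_nrm _).
  by case: (z n) (z m) => [? ?] [? ?].
exists (r +i* i) => n; apply: le_trans (nrm_le_ReIm _) _.
rewrite mulrnAl mulr2n; have := rP n; have := iP n.
by case: (z n) => x y /= *; rewrite lerD.
Qed.

(** The next two lemmas translate between the completeness of a uniform space,
    which concerns filters, and convergence of fast Cauchy sequences. *)
Lemma complete_fast_cauchy (V : completeNormedModType C) (u : nat -> V) :
  (forall n m, nrm (u n - u m) <= rate n + rate m) ->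
  exists l, forall e : R, 0 < e -> exists2 n : nat,
     rate n <= e & nrm (l - u n) <= e.
Proof.
move=> uM.
have : cvg (u @ \oo).
  apply/cauchy_cvgP/cauchy_exP => e e0.
  have ep : 0 < complex.Re e / 4 by rewrite divr_gt0//; move: e0; rewrite ltcE => /andP[].
  have [N NP] := rate_small ep.
  exists (u N); exists N => // n /= Nn.
  rewrite -ball_normE /= nrmE -(RRe_real (gtr0_real e0)) ltcR.
  apply: le_lt_trans (uM N n) _.
  by have := NP N (leqnn _); have := NP n Nn; lra.
move=> /cvg_ex[l ul]; exists l => e e0.
have [N1 N1P] := rate_small e0.
have e0' : 0 < e%:C by rewrite ltcR.
move/cvgrPdist_le : ul => /(_ _ e0')[N2 _ N2P].
exists (maxn N1 N2); first by apply/ltW/N1P; rewrite leq_maxl.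
by rewrite -nrm_le; apply: N2P; rewrite /= leq_maxr.
Qed.

Lemma fast_cauchy_complete (V : normedModType C) :
  (forall u : nat -> V,
    (forall n m, nrm (u n - u m) <= rate n + rate m) ->
    exists l, exists M : R, forall n, nrm (l - u n) <= M * rate n) ->
  forall F : set_system V, ProperFilter F -> cauchy F -> cvg F.
Proof.
move=> cV F FF /cauchyP cF.
have inv_gt0 n : 0 < rate n by exact: rate_gt0.
have /choice[u uP] (n : nat) : exists x : V, F (ball x (rate n)%:C).
  by apply: cF; rewrite ltcR.
have [n m|l [M lP]] := cV u.
  have [y []] := filter_ex (filterI (uP n) (uP m)).
  rewrite -!ball_normE/= !nrmE !ltcR => yn ym.
  by rewrite (le_trans (nrm_trans y _ _))// [nrm (y - _)]nrmB lerD// ltW.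
apply/cvg_ex; exists l; apply/cvgrPdist_lt => e e0.
have {}e0 : 0 < complex.Re e /\ e = (complex.Re e)%:C.
  by split; [move: e0; rewrite ltcE => /andP[]|rewrite RRe_real// gtr0_real].
move: e0 => [e0 ->].
have M1 : 0 < `|M| + 1 by rewrite ltr_wpDl.
have [n /(_ _ (leqnn _)) nP] := rate_small (divr_gt0 e0 M1).
rewrite ltr_pdivlMr// mulrC in nP.
apply: filterS (uP n) => y; rewrite -ball_normE/= !nrmE !ltcR => yn.
apply: le_lt_trans (nrm_trans (u n) _ _) _; apply: le_lt_trans nP.
rewrite mulrDl mul1r lerD//; last exact: ltW.
by apply: le_trans (lP n) _; rewrite ler_wpM2r ?ler_norm// ltW.
Qed.

End real_norm.

(** * Semi-inner products and approximate representation *)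

Section semi_inner_product.
Variables (R : realType) (E : lmodType R[i]).
Local Notation C := R[i].

(** Unlike for a dot product, nonzero vectors may have [sform u u = 0]; this is
    what a positive definite kernel provides. *)
Record semi_inner := SemiInner {
  sform :> E -> E -> C;
  sform_linear : forall a u v w,
    sform (a *: u + v) w = a * sform u w + sform v w;
  sform_herm : forall u v, sform u v = Num.conj (sform v u);
  sform_ge0 : forall u, 0 <= sform u u }.

Definition conj_linear (phi : E -> C) :=
  forall a f g, phi (a *: f + g) = Num.conj a * phi f + phi g.

Lemma conj_linear0 phi : conj_linear phi -> phi 0 = 0.
Proof.
move=> lphi; have := lphi (-1) 0 0.
by rewrite scaler0 addr0 rmorphN1 mulN1r addNr.
Qed.

Lemma conj_linearZ phi a f : conj_linear phi -> phi (a *: f) = Num.conj a * phi f.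
Proof. by move=> lphi; rewrite -[a *: f]addr0 lphi conj_linear0// addr0. Qed.

Lemma conj_linearB phi f g : conj_linear phi -> phi (f - g) = phi f - phi g.
Proof.
move=> lphi; rewrite addrC -scaleN1r lphi rmorphN1 mulN1r.
by rewrite addrC.
Qed.

Variable s : semi_inner.

Lemma sform_conj_linear u : conj_linear (s u).
Proof.
by move=> a f g; rewrite sform_herm sform_linear rmorphD rmorphM/= -!sform_herm.
Qed.

Lemma sformBl u v w : s (u - v) w = s u w - s v w.
Proof. by rewrite addrC -scaleN1r sform_linear mulN1r addrC. Qed.

Definition ssnorm (u : E) : R := Num.sqrt (complex.Re (s u u)).

Lemma ssnorm_ge0 u : 0 <= ssnorm u.
Proof. exact: sqrtr_ge0. Qed.

Lemma ssnorm_sqr u : ssnorm u ^+ 2 = complex.Re (s u u).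
Proof. by rewrite sqr_sqrtr// Re_ge0// sform_ge0. Qed.

Lemma sform_ssnorm u : s u u = (ssnorm u ^+ 2)%:C.
Proof. by rewrite ssnorm_sqr -ge0_ReE// sform_ge0. Qed.

Lemma ssnorm_le u M : nrm (s u u) <= M * ssnorm u -> 0 <= M -> ssnorm u <= M.
Proof.
rewrite sform_ssnorm /nrm normc_def/= expr0n/= addr0 sqrtr_sqr.
rewrite ger0_norm ?sqr_ge0// expr2 => uM M0.
have [u0|u0] := eqVneq (ssnorm u) 0; first by rewrite u0.
by rewrite ler_pM2r// in uM; rewrite lt_neqAle eq_sym u0 ssnorm_ge0.
Qed.

(** The real part of s(v, v) - 2 phi(v) at v = u - t c f, for c = s(u, f) - phi(f),
    written in terms of x = s(u, f), p = phi(f), a = s(u, u), b = phi(u) and the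
    seminorm n of f. *)
Lemma quadratic_expansion (x p a b : C) (t n : R) (c := x - p) :
  complex.Re (- (t%:C * c) * (- (t%:C * Num.conj c) * (n ^+ 2)%:C + Num.conj x)
    + (- (t%:C * Num.conj c) * x + a))
  - complex.Re (- (t%:C * Num.conj c) * p + b) *+ 2 =
  complex.Re a - complex.Re b *+ 2
    + (t ^+ 2 * nrm c ^+ 2 * n ^+ 2 - t * nrm c ^+ 2 *+ 2).
Proof.
rewrite nrm_sqr {}/c; case: x p a b => [x1 x2] [p1 p2] [a1 a2] [b1 b2].
rewrite conj_complexE conj_complexE /=; ring.
Qed.

(** Comparing the functional q(v) = s(v, v) - 2 Re phi(v) at [u] and at
    u - t (s(u, f) - phi(f)) f for all real t gives a nonnegative quadratic
    polynomial in t, whose discriminant is the claim: the derivative of q almost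
    vanishes where q is almost minimal. *)
Lemma near_minimizer phi u (e : R) : conj_linear phi -> 0 <= e ->
  (forall v, complex.Re (s u u) - complex.Re (phi u) *+ 2 - e ^+ 2 <=
             complex.Re (s v v) - complex.Re (phi v) *+ 2) ->
  forall f, nrm (phi f - s u f) <= e * ssnorm f.
Proof.
move=> lphi e0 umin f; rewrite -ler_sqr ?nnegrE ?nrm_ge0 ?mulr_ge0 ?ssnorm_ge0//.
rewrite exprMn; apply: discriminant; rewrite ?sqr_ge0// => t.
rewrite nrmB; set c := s u f - phi f.
have := umin (- (t%:C * c) *: f + u).
rewrite lphi sform_linear !sform_conj_linear.
rewrite (sform_herm s f u) !rmorphN !rmorphM/= conj_real (sform_ssnorm f).
rewrite quadratic_expansion -/c.
by move: (complex.Re _) (complex.Re _) (nrm c) (ssnorm f) => a b n m; lra.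
Qed.

(** For [phi = 0], q is the square of the seminorm, and any [u] minimizes it up
    to its own value: Cauchy-Schwarz is an instance of [near_minimizer]. *)
Lemma sform_CauchySchwarz u f : nrm (s u f) <= ssnorm u * ssnorm f.
Proof.
rewrite -nrmN -[- _]add0r; apply: (@near_minimizer (fun=> 0)).
- by move=> a g h; rewrite mulr0 addr0.
- exact: ssnorm_ge0.
- move=> v; rewrite /= mul0rn !subr0 ssnorm_sqr subrr.
  by rewrite Re_ge0// sform_ge0.
Qed.

Definition functional_bound (phi : E -> C) (m : R) :=
  0 <= m /\ forall f, nrm (phi f) <= m * ssnorm f.

Definition represents_upto (phi : E -> C) (e : R) (u : E) :=
  forall f, nrm (phi f - s u f) <= e * ssnorm f.

(** The functional q of [near_minimizer] is bounded below by - m^2, hence has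
    near minimizers even when [E] is not complete. *)
Lemma approximate_Riesz phi m e : conj_linear phi -> functional_bound phi m ->
  0 < e -> exists u, represents_upto phi e u.
Proof.
move=> lphi [m0 phim] e0.
pose q u := complex.Re (s u u) - complex.Re (phi u) *+ 2.
have qm u : - m ^+ 2 <= q u.
  rewrite /q -ssnorm_sqr; have := le_trans (Re_le_nrm _) (phim u).
  have := sqr_ge0 (ssnorm u - m); rewrite sqrrB.
  by move: (complex.Re _) (ssnorm u) => a b; lra.
have inf_q : has_inf (range q).
  by split; [exists (q 0), 0|exists (- m ^+ 2) => _ [u _ <-]; exact: qm].
have [_ [u _ <-] qu] := inf_adherent (exprn_gt0 2 e0) inf_q.
exists u; apply: near_minimizer => //; first exact: ltW.
move=> v; rewrite -/(q u) -/(q v) lerBlDr; apply: ltW.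
apply: lt_le_trans qu _; rewrite lerD2r.
by apply: ge_inf; [case: inf_q|exists v].
Qed.

Lemma represents_ssnorm phi m e u : functional_bound phi m ->
  0 <= e -> represents_upto phi e u -> ssnorm u <= m + e.
Proof.
move=> [m0 phim] e0 phiu; apply: ssnorm_le; last exact: addr_ge0.
rewrite mulrDl; apply: le_trans (lerD (phim u) (phiu u)).
rewrite addrC -lerBlDr; have := nrm_trans (phi u) (s u u) 0.
by rewrite !subr0 nrmB; lra.
Qed.

Lemma represents_dist phi e1 e2 u v : 0 <= e1 -> 0 <= e2 ->
  represents_upto phi e1 u -> represents_upto phi e2 v ->
  ssnorm (u - v) <= e1 + e2.
Proof.
move=> e10 e20 phiu phiv; apply: ssnorm_le; last exact: addr_ge0.
rewrite {1}sformBl; apply: le_trans (nrm_trans (phi (u - v)) _ _) _.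
by rewrite nrmB mulrDl lerD.
Qed.

End semi_inner_product.

(** * The Hilbert space completion of a semi-inner product *)

Section completion.
Variables (R : realType) (E : lmodType R[i]) (s : semi_inner E).
Local Notation C := R[i].
Local Notation rate := (@rate R).

Definition bounded_conj_linear : {pred E -> C} :=
  [pred phi : E -> C | `[< conj_linear phi /\ exists m, functional_bound s phi m >]].

Lemma bounded_conj_linear_submod : submod_closed bounded_conj_linear.
Proof.
split.
  apply/asboolP; split; first by move=> a f g; rewrite mulr0 addr0.
  by exists 0; split=> // f; rewrite nrm0 mul0r.
move=> a phi psi /asboolP[lphi [m [m0 mphi]]] /asboolP[lpsi [n [n0 npsi]]].
apply/asboolP; split.
  move=> b f g; rewrite /= fctE /=.
  change (a * phi (b *: f + g) + psi (b *: f + g) =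
    Num.conj b * (a * phi f + psi f) + (a * phi g + psi g)).
  by rewrite lphi lpsi; ring.
exists (nrm a * m + n); split; first by rewrite addr_ge0 ?mulr_ge0 ?nrm_ge0.
move=> f; apply: le_trans (nrmD _ _) _; rewrite mulrDl lerD//.
by rewrite nrmM -mulrA ler_wpM2l ?nrm_ge0.
Qed.

HB.instance Definition _ := GRing.isSubmodClosed.Build C (E -> C)
  bounded_conj_linear bounded_conj_linear_submod.

(** The elements of the completion are the functionals that they induce on [E];
    [u : E] corresponds to [s u]. Conjugate-linear functionals make this
    embedding linear. *)
Record completion := Completion {
  functional :> E -> C;
  functionalP : functional \in bounded_conj_linear }.

HB.instance Definition _ := [isSub for functional].
HB.instance Definition _ := [Choice of completion by <:].
HB.instance Definition _ := [SubChoice_isSubLmodule of completion by <:].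

Implicit Types phi psi : completion.

Lemma completion_linear phi : conj_linear phi.
Proof. by have /asboolP[] := functionalP phi. Qed.

Lemma completion_bound phi : exists m, functional_bound s phi m.
Proof. by have /asboolP[] := functionalP phi. Qed.

Lemma completionP a phi psi f : (a *: phi + psi) f = a * phi f + psi f.
Proof. by []. Qed.

Lemma completionB phi psi f : (phi - psi) f = phi f - psi f.
Proof. by []. Qed.

Lemma completion_ext phi psi : (forall f, phi f = psi f) -> phi = psi.
Proof. by move=> e; apply/val_inj/funext. Qed.

Lemma represents_exists phi e : 0 < e -> exists u, represents_upto s phi e u.
Proof.
move=> e0; have [m mphi] := completion_bound phi.
exact: approximate_Riesz (completion_linear phi) mphi e0.
Qed.

(** The inner product <phi, psi> is the limit of phi(v) along vectors [v] that
    represent [psi] better and better. Stating the rate makes [c] unique and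
    gives directly every estimate needed. *)
Definition is_pairing phi psi (c : C) := forall m e v,
  functional_bound s phi m -> 0 <= e -> represents_upto s psi e v ->
  nrm (c - phi v) <= m * e.

(** If [v n] represents [psi] up to [rate n], then the seminorm of v n - v m is at
    most rate n + rate m, so that phi(v n) is a fast Cauchy sequence. *)
Lemma pairing_exists phi psi : exists c, is_pairing phi psi c.
Proof.
have /choice[v vP] n := represents_exists psi (rate_gt0 R n).
have dist m u e n : functional_bound s phi m -> 0 <= e -> represents_upto s psi e u ->
    nrm (phi u - phi (v n)) <= m * (e + rate n).
  move=> [m0 mphi] e0 ue; rewrite -conj_linearB; last exact: completion_linear.
  apply: le_trans (mphi _) _; rewrite ler_wpM2l//.
  exact: represents_dist e0 (ltW (rate_gt0 R n)) ue (vP n).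
have [m mphi] := completion_bound phi; have [m0 _] := mphi.
have [|c cP] := @complex_fast_cauchy R (fun n => phi (v n)) m m0.
  by move=> n k; apply: dist (vP n) => //; exact/ltW/rate_gt0.
exists c => m' e u [m'0 m'phi] e0 ue.
rewrite -subr_le0; apply: (@le0_of_small R _ (m *+ 2 + m')) => d /andP[d0 _].
have [n /(_ _ (leqnn _))/ltW nd] := rate_small d0.
have h1 := cP n; have h2 := dist m' u e n (conj m'0 m'phi) e0 ue.
have h3 := nrm_trans (phi (v n)) c (phi u); rewrite [nrm (phi (v n) - _)]nrmB in h3.
have h4 : m *+ 2 * rate n <= m *+ 2 * d by rewrite ler_wpM2l// mulrn_wge0.
have h5 : m' * rate n <= m' * d by rewrite ler_wpM2l.
by rewrite mulrDl; rewrite mulrDr in h2; lra.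
Qed.

Definition pairing phi psi : C := xget 0 (is_pairing phi psi).

Lemma pairingP phi psi : is_pairing phi psi (pairing phi psi).
Proof. exact: xgetPex (pairing_exists phi psi). Qed.

Lemma pairing_linear a phi phi' psi :
  pairing (a *: phi + phi') psi = a * pairing phi psi + pairing phi' psi.
Proof.
have [m mphi] := completion_bound phi; have [m' mphi'] := completion_bound phi'.
have [M Mphi] := completion_bound (a *: phi + phi').
apply/eqP; rewrite -subr_eq0; apply/eqP.
apply: (@nrm_small _ _ _ (M + (nrm a * m + m'))) => e /andP[e0 _].
have [v vP] := represents_exists psi e0.
apply: le_trans (nrm_trans ((a *: phi + phi') v) _ _) _.
rewrite mulrDl; apply: lerD; first by apply: (pairingP Mphi _ vP); exact: ltW.
rewrite completionP nrmB opprD addrACA -mulrBr.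
rewrite mulrDl -mulrA; apply: le_trans (nrmD _ _) _; rewrite lerD//.
  by rewrite nrmM ler_wpM2l ?nrm_ge0//; apply: (pairingP mphi _ vP); exact: ltW.
by apply: (pairingP mphi' _ vP); exact: ltW.
Qed.

(** The pairing is also a limit of values of the form [s], from which it inherits
    symmetry and positivity. *)
Lemma nrm_pairing_represents phi psi m n e u v :
  functional_bound s phi m -> functional_bound s psi n -> 0 <= e ->
  represents_upto s phi e u -> represents_upto s psi e v ->
  nrm (pairing phi psi - s u v) <= (m + n + e) * e.
Proof.
move=> mphi npsi e0 ue ve; apply: le_trans (nrm_trans (phi v) _ _) _.
rewrite -addrA mulrDl lerD//; first exact: pairingP ve.
apply: le_trans (ue v) _; rewrite mulrC ler_wpM2r//.
exact: represents_ssnorm ve.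
Qed.

Lemma pairing_herm phi psi : pairing phi psi = Num.conj (pairing psi phi).
Proof.
have [m mphi] := completion_bound phi; have [n npsi] := completion_bound psi.
have [m0 _] := mphi; have [n0 _] := npsi.
apply/eqP; rewrite -subr_eq0; apply/eqP.
apply: (@nrm_small _ _ _ ((m + n + 1) *+ 2)) => e /andP[e0 e1].
have [u uP] := represents_exists phi e0; have [v vP] := represents_exists psi e0.
have e0' := ltW e0.
have h1 := nrm_pairing_represents mphi npsi e0' uP vP.
have h2 := nrm_pairing_represents npsi mphi e0' vP uP.
rewrite -nrm_conj rmorphB/= -sform_herm (addrC n) in h2.
apply: le_trans (nrm_trans (s u v) _ _) _; rewrite [nrm (s u v - _)]nrmB.
apply: le_trans (lerD h1 h2) _; rewrite -mulr2n mulrnAl ler_wMn2r//.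
by rewrite ler_wpM2r// lerD2l.
Qed.

Lemma represents_bound phi e u : 0 <= e -> represents_upto s phi e u ->
  functional_bound s phi (ssnorm s u + e).
Proof.
move=> e0 ue; split=> [|f]; first by rewrite addr_ge0// ssnorm_ge0.
have := nrm_trans (s u f) (phi f) 0; rewrite !subr0 => h.
apply: le_trans h _; rewrite addrC mulrDl lerD//.
exact: sform_CauchySchwarz.
Qed.

Lemma pairing_real phi : pairing phi phi = (complex.Re (pairing phi phi))%:C.
Proof. by rewrite RRe_real//; apply/CrealP; rewrite -pairing_herm. Qed.

Lemma pairing_ssnorm phi e u : 0 <= e -> represents_upto s phi e u ->
  `|complex.Re (pairing phi phi) - ssnorm s u ^+ 2| <=
    (ssnorm s u *+ 2 + e *+ 3) * e.
Proof.
move=> e0 ue; have mphi := represents_bound e0 ue.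
apply: le_trans (_ : (ssnorm s u + e + (ssnorm s u + e) + e) * e <= _); last first.
  by rewrite le_eqVlt; apply/orP; left; apply/eqP; ring.
apply: le_trans (nrm_pairing_represents mphi mphi e0 ue ue).
rewrite ssnorm_sqr -ReB; exact: Re_norm_le_nrm.
Qed.

Lemma pairing_ge0 phi : 0 <= complex.Re (pairing phi phi).
Proof.
have [m mphi] := completion_bound phi; have [m0 _] := mphi.
rewrite -oppr_le0; apply: (@le0_of_small _ _ ((m + 1) *+ 2 + 3)) => e /andP[e0 e1].
have [u uP] := represents_exists phi e0; have e0' := ltW e0.
have := pairing_ssnorm e0' uP; rewrite ler_norml => /andP[h _].
have h2 := represents_ssnorm mphi e0' uP.
have h3 : (ssnorm s u *+ 2 + e *+ 3) * e <= ((m + 1) *+ 2 + 3) * e.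
  by rewrite ler_wpM2r//; lra.
by have := sqr_ge0 (ssnorm s u); lra.
Qed.

(** With [pairing_le], this says that the norm of the pairing is the operator
    norm of functionals; it also shows that the pairing is definite. *)
Lemma functional_CauchySchwarz phi f :
  nrm (phi f) ^+ 2 <= complex.Re (pairing phi phi) * ssnorm s f ^+ 2.
Proof.
have [m mphi] := completion_bound phi; have [m0 _] := mphi.
rewrite -subr_le0.
apply: (@le0_of_small _ _ ((m *+ 4 + 8) * ssnorm s f ^+ 2)) => e /andP[e0 e1].
have [u uP] := represents_exists phi e0; have e0' := ltW e0.
have := pairing_ssnorm e0' uP; rewrite ler_norml => /andP[h _].
have h2 := represents_ssnorm mphi e0' uP.
have [_ /(_ f)] := represents_bound e0' uP.
rewrite -ler_sqr ?nnegrE ?nrm_ge0 ?mulr_ge0 ?addr_ge0 ?ssnorm_ge0// => h3.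
rewrite lerBlDr; apply: le_trans h3 _.
rewrite exprMn [X in _ <= X + _]mulrAC -mulrDl ler_wpM2r ?sqr_ge0//.
have h4 : (ssnorm s u *+ 4 + e *+ 4) * e <= (m *+ 4 + 8) * e.
  by rewrite ler_wpM2r//; lra.
by move: (complex.Re _) (ssnorm s u) h h2 h4 => P t *; nra.
Qed.

Lemma pairing_le phi m : functional_bound s phi m ->
  complex.Re (pairing phi phi) <= m ^+ 2.
Proof.
move=> mphi; have [m0 phim] := mphi; rewrite -subr_le0.
apply: (@le0_of_small _ _ (m *+ 2)) => e /andP[e0 _].
have [u uP] := represents_exists phi e0; have e0' := ltW e0.
have h1 := pairingP mphi e0' uP.
have h2 := le_trans (phim u) (ler_wpM2l m0 (represents_ssnorm mphi e0' uP)).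
have := Re_le_nrm (pairing phi phi).
have := nrm_trans (phi u) (pairing phi phi) 0; rewrite !subr0.
by rewrite mulrDr -expr2 in h2; lra.
Qed.

Lemma pairing_bilinear :
  bilinear_for *%R (Num.conj \; *%R : C -> C -> C) pairing.
Proof.
split=> psi a phi phi' /=; first exact: pairing_linear.
by rewrite pairing_herm pairing_linear rmorphD rmorphM/= -!pairing_herm.
Qed.

HB.instance Definition _ :=
  @bilinear_isBilinear.Build _ _ _ _ _ _ pairing pairing_bilinear.

Lemma pairing_hermitian phi psi :
  pairing phi psi = (-1) ^+ false * Num.conj (pairing psi phi).
Proof. by rewrite mul1r -pairing_herm. Qed.

HB.instance Definition _ := @isHermitianSesquilinear.Build
  C completion false Num.conj pairing pairing_hermitian.

Lemma pairing_gt0 phi : phi != 0 -> 0 < pairing phi phi.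
Proof.
move=> phi0; rewrite pairing_real ltcR lt_neqAle pairing_ge0 andbT.
apply: contra_neq phi0 => pairing0; apply: completion_ext => f.
apply/nrm_eq0/eqP; rewrite -sqrf_eq0 eq_le sqr_ge0 andbT.
by apply: le_trans (functional_CauchySchwarz phi f) _; rewrite -pairing0 mul0r.
Qed.

HB.instance Definition _ := @isDotProduct.Build C completion pairing pairing_gt0.

HB.instance Definition _ := @Lmodule_isHilbert.Build R completion pairing.

Lemma completion_nrm_sqr phi : nrm phi ^+ 2 = complex.Re (pairing phi phi).
Proof.
have : pairing phi phi = `|phi| ^+ 2 by rewrite sqrtCK.
by rewrite nrmE -rmorphXn => ->.
Qed.

Lemma functional_bound_nrm phi : functional_bound s phi (nrm phi).
Proof.
split=> [|f]; first exact: nrm_ge0.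
rewrite -ler_sqr ?nnegrE ?nrm_ge0 ?mulr_ge0 ?nrm_ge0 ?ssnorm_ge0//.
by rewrite exprMn completion_nrm_sqr functional_CauchySchwarz.
Qed.

Lemma nrm_functional_bound phi m : functional_bound s phi m -> nrm phi <= m.
Proof.
move=> mphi; have [m0 _] := mphi.
by rewrite -ler_sqr ?nnegrE ?nrm_ge0// completion_nrm_sqr pairing_le.
Qed.

(** Since the norm is the operator norm, Cauchy sequences converge pointwise on
    [E], uniformly with respect to the seminorm. *)
Lemma completion_fast_cauchy (u : nat -> completion) :
  (forall n m, nrm (u n - u m) <= rate n + rate m) ->
  exists l, exists M : R, forall n, nrm (l - u n) <= M * rate n.
Proof.
move=> uM.
have /choice[l lP] f : exists c, forall n,
    nrm (c - u n f) <= ssnorm s f *+ 2 * rate n.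
  apply: complex_fast_cauchy => [|n m]; first exact: ssnorm_ge0.
  rewrite -completionB mulrC.
  apply: le_trans ((functional_bound_nrm (u n - u m)).2 f) _.
  by rewrite ler_wpM2r ?ssnorm_ge0.
have llin : conj_linear l.
  move=> a f g; apply/eqP; rewrite -subr_eq0; apply/eqP.
  pose K := ssnorm s (a *: f + g) *+ 2
    + (nrm a * (ssnorm s f *+ 2) + ssnorm s g *+ 2).
  have K0 : 0 <= K.
    by rewrite !addr_ge0 ?mulr_ge0 ?nrm_ge0 ?mulrn_wge0 ?ssnorm_ge0.
  apply: (@nrm_small _ _ _ K) => e /andP[e0 _].
  have [n /(_ _ (leqnn _))/ltW ne] := rate_small e0.
  apply: le_trans (ler_wpM2l K0 ne); rewrite /K.
  apply: le_trans (nrm_trans (u n (a *: f + g)) _ _) _.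
  rewrite mulrDl lerD// completion_linear.
  rewrite opprD addrACA -mulrBr mulrDl -mulrA; apply: le_trans (nrmD _ _) _.
  by rewrite nrmM nrm_conj ![nrm (u n _ - _)]nrmB lerD// ler_wpM2l ?nrm_ge0.
have l_near n f : nrm (l f - u n f) <= rate n *+ 2 * ssnorm s f.
  by rewrite mulrnAl mulrC -mulrnAl.
have lbound : functional_bound s l (nrm (u 0%N) + rate 0 *+ 2).
  split=> [|f]; first by rewrite addr_ge0 ?nrm_ge0// mulrn_wge0// ltW// rate_gt0.
  have := nrm_trans (u 0%N f) (l f) 0; rewrite !subr0 => h; apply: le_trans h _.
  rewrite addrC mulrDl lerD//; exact: (functional_bound_nrm _).2.
have lP' : l \in bounded_conj_linear.
  by apply/asboolP; split=> //; eexists; exact: lbound.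
exists (Completion lP'), 2 => n.
rewrite mulrC mulr_natr; apply: nrm_functional_bound; split=> [|f].
  by rewrite mulrn_wge0// ltW// rate_gt0.
exact: l_near.
Qed.

Lemma completion_complete (F : set_system completion) :
  ProperFilter F -> cauchy F -> cvg F.
Proof. apply: fast_cauchy_complete; exact: completion_fast_cauchy. Qed.

HB.instance Definition _ :=
  @Uniform_isComplete.Build completion completion_complete.

End completion.

HB.saturate completion.

Section embedding.
Variables (R : realType) (E : lmodType R[i]) (s : semi_inner E).
Local Notation C := R[i].

Lemma form_bounded_conj_linear f : (s f : E -> C) \in bounded_conj_linear s.
Proof.
apply/asboolP; split; first exact: sform_conj_linear.
exists (ssnorm s f); split; first exact: ssnorm_ge0.
exact: sform_CauchySchwarz.
Qed.

Definition embed (f : E) : completion s := Completion (form_bounded_conj_linear f).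

Lemma embed_linear a f g : embed (a *: f + g) = a *: embed f + embed g.
Proof. by apply: completion_ext => h; exact: sform_linear. Qed.

(** The reproducing property: the value of a functional is an inner product. *)
Lemma inner_embed (phi : completion s) f : inner phi (embed f) = phi f.
Proof.
apply/eqP; rewrite -subr_eq0; apply/eqP/(@nrm_small _ _ _ 0) => e _.
rewrite mul0r -(mulr0 (nrm phi)).
apply: (@pairingP _ _ s phi (embed f)) => //; first exact: functional_bound_nrm.
by move=> h; rewrite subrr nrm0 mul0r.
Qed.

Lemma embed_dense (phi : completion s) e : 0 < e -> exists f, nrm (phi - embed f) <= e.
Proof.
move=> e0; have [f fP] := represents_exists phi e0.
exists f; apply: nrm_functional_bound; split; first exact: ltW.
exact: fP.
Qed.

Lemma nrm_embed f : nrm (embed f) = ssnorm s f.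
Proof.
rewrite -[LHS]ger0_norm ?nrm_ge0// -sqrtr_sqr completion_nrm_sqr.
by congr (Num.sqrt (complex.Re _)); exact: inner_embed.
Qed.

Lemma embed_sum (I : Type) (r : seq I) (F : I -> E) :
  embed (\sum_(i <- r) F i) = \sum_(i <- r) embed (F i).
Proof.
apply: (big_morph embed) => [f g|].
  by rewrite -[f]scale1r embed_linear !scale1r.
by have := embed_linear (-1) 0 0; rewrite scaler0 addr0 scaleN1r addNr.
Qed.

End embedding.

(** * Riesz representation and adjoints *)

Section hilbert_spaces.
Variable R : realType.
Local Notation C := R[i].
Implicit Types H K : hilbertType R.

Section inner_product.
Variable H : hilbertType R.
Implicit Types x y z : H.

Lemma inner_linear a x y z : inner (a *: x + y) z = a * inner x z + inner y z.
Proof. by rewrite linearPl. Qed.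

Lemma inner_herm x y : inner x y = Num.conj (inner y x).
Proof. by rewrite hermC/= mul1r. Qed.

Definition inner_form : semi_inner H :=
  SemiInner inner_linear inner_herm (fun x => dnorm_ge0 inner x).

Lemma inner_nrm x : inner x x = (nrm x ^+ 2)%:C.
Proof. by rewrite inner_norm nrmE rmorphXn. Qed.

Lemma ssnorm_inner_form x : ssnorm inner_form x = nrm x.
Proof. by rewrite /ssnorm /= inner_nrm sqrtr_sqr ger0_norm// nrm_ge0. Qed.

Lemma inner_conj_linear x : conj_linear (inner x).
Proof. exact: (sform_conj_linear inner_form). Qed.

Lemma inner_CauchySchwarz x y : nrm (inner x y) <= nrm x * nrm y.
Proof. by rewrite -!ssnorm_inner_form; exact: (sform_CauchySchwarz inner_form). Qed.

Lemma inner_ext x y : (forall z, inner x z = inner y z) -> x = y.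
Proof.
move=> xy; apply/eqP; rewrite -subr_eq0; apply/eqP/nrm_eq0/eqP.
rewrite -sqrf_eq0; apply/eqP/(@complexI R); rewrite -inner_nrm.
by rewrite linearBl/= xy subrr.
Qed.

Lemma inner_sum (I : Type) (r : seq I) (P Q : I -> H) :
  inner (\sum_(y <- r) P y) (\sum_(x <- r) Q x) =
  \sum_(x <- r) \sum_(y <- r) inner (P y) (Q x).
Proof. by rewrite linear_sumr/=; apply: eq_bigr => x _; rewrite linear_sumlz. Qed.

(** Vectors that represent [phi] up to [rate n] form a Cauchy sequence, and their
    limit represents [phi] exactly. *)
Lemma Riesz_representation (phi : H -> C) (m : R) : conj_linear phi -> 0 <= m ->
  (forall x, nrm (phi x) <= m * nrm x) -> exists y, forall x, phi x = inner y x.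
Proof.
move=> lphi m0 phim.
have mphi : functional_bound inner_form phi m.
  by split=> // x; rewrite ssnorm_inner_form.
have /choice[u uP] n := approximate_Riesz lphi mphi (rate_gt0 R n).
have [n k|y yP] := @complete_fast_cauchy R H u.
  rewrite -ssnorm_inner_form; apply: represents_dist (uP n) (uP k);
    exact/ltW/rate_gt0.
exists y => x; apply/eqP; rewrite -subr_eq0; apply/eqP.
apply: (@nrm_small _ _ _ (nrm x *+ 2)) => e /andP[e0 _].
have [n ne yn] := yP e e0.
apply: le_trans (nrm_trans (inner (u n) x) _ _) _.
rewrite mulrnAl mulr2n mulrC lerD//.
  by apply: le_trans (uP n x) _; rewrite ssnorm_inner_form ler_wpM2r// nrm_ge0.
rewrite -linearBl/=; apply: le_trans (inner_CauchySchwarz _ _) _.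
by rewrite nrmB ler_wpM2r// nrm_ge0.
Qed.

End inner_product.

Lemma bounded_opP H K (T : bounded_op H K) :
  exists2 M : R, 0 <= M & forall x, nrm (T x) <= M * nrm x.
Proof.
have [M M0 TM] := bounded_op_ge0 T; exists (complex.Re M); first exact: Re_ge0.
by move=> x; rewrite -lecR rmorphM/= -!nrmE -ge0_ReE.
Qed.

Lemma bounded_op_exists H K (f : H -> K) (M : R) : linear f ->
  (forall x, nrm (f x) <= M * nrm x) -> exists T : bounded_op H K, T =1 f.
Proof.
move=> lf fM.
pose lin := GRing.isLinear.Build _ _ _ _ f lf.
have bnd : exists M : R, forall x, `|f x| <= M%:C * `|x|.
  by exists M => x; rewrite !nrmE -rmorphM lecR.
pose fB := isBoundedOp.Build R H K f bnd.
pose T : bounded_op H K := HB.pack f lin fB.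
by exists T.
Qed.

Lemma comp_op_exists H1 H2 H3 (S : bounded_op H2 H3)
    (T : bounded_op H1 H2) :
  exists ST : bounded_op H1 H3, ST =1 S \o T.
Proof.
have [M M0 SM] := bounded_opP S; have [N N0 TN] := bounded_opP T.
apply: (@bounded_op_exists _ _ _ (M * N)).
  by move=> a x y; rewrite /= !linearP.
by move=> x; rewrite -mulrA (le_trans (SM _))// ler_wpM2l.
Qed.

Lemma adjoint_exists H K (T : bounded_op H K) : exists S, is_adjoint T S.
Proof.
have [M M0 TM] := bounded_opP T.
have /choice[S SP] y : exists z, forall x, inner y (T x) = inner z x.
  apply: (@Riesz_representation _ _ (nrm y * M)).
  - by move=> a x z; rewrite linearP inner_conj_linear.
  - by rewrite mulr_ge0// nrm_ge0.
  move=> x; apply: le_trans (inner_CauchySchwarz _ _) _.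
  by rewrite -mulrA ler_wpM2l// nrm_ge0.
have Slin : linear S.
  by move=> a x y; apply: inner_ext => z; rewrite inner_linear -!SP inner_linear.
have Sbound y : nrm (S y) <= M * nrm y.
  rewrite -ssnorm_inner_form; apply: ssnorm_le; last by rewrite mulr_ge0// nrm_ge0.
  rewrite ssnorm_inner_form/= -SP (le_trans (inner_CauchySchwarz _ _))//.
  by rewrite (mulrC M) -mulrA ler_wpM2l// nrm_ge0.
have [S' S'E] := bounded_op_exists Slin Sbound.
by exists S' => x y; rewrite S'E inner_herm SP -inner_herm.
Qed.

Lemma adjointP H K (T : bounded_op H K) : is_adjoint T (adjoint T).
Proof. exact: xgetPex (adjoint_exists T). Qed.

Lemma inner_adjoint H K (T : bounded_op H K) x y :
  inner (adjoint T x) y = inner x (T y).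
Proof. by rewrite inner_herm -adjointP -inner_herm. Qed.

Lemma adjoint_unique H K (T : bounded_op H K) S : is_adjoint T S -> adjoint T =1 S.
Proof.
move=> TS y; apply: inner_ext => x.
by rewrite inner_adjoint inner_herm TS -inner_herm.
Qed.

(** The operator norm is the supremum over the unit ball; a nonzero vector is
    reached from it by scaling. *)
Lemma contraction_opP H (T : bounded_op H H) :
  contraction_op T <-> forall x, nrm (T x) <= nrm x.
Proof.
split=> [T1 x|T1]; last first.
  apply: ge_sup; first by exists (nrm (T 0)), 0 => //=; rewrite normr0 ler01.
  move=> _ [x /= x1 <-]; apply: le_trans (T1 x) _.
  by rewrite -lecR -nrmE.
have [x0|x_neq0] := eqVneq (nrm x) 0.
  by rewrite (nrm_eq0 x0) linear0 !nrm0.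
have x_gt0 : 0 < nrm x by rewrite lt_neqAle eq_sym x_neq0 nrm_ge0.
pose y := (nrm x)^-1%:C *: x.
have nrm_inv : nrm (nrm x)^-1%:C = (nrm x)^-1.
  by rewrite /nrm ger0_norm ?ler0c ?invr_ge0 ?nrm_ge0.
have Ty : nrm (T y) <= 1.
  apply: le_trans T1; apply: ub_le_sup; last first.
    by exists y => //=; rewrite nrm_le nrmZ nrm_inv mulVf.
  have [M M0 TM] := bounded_opP T; exists M => _ [z /= z1 <-].
  apply: le_trans (TM z) _; rewrite nrm_le in z1.
  by rewrite -[leRHS]mulr1 ler_wpM2l.
by move: Ty; rewrite /y linearZ nrmZ nrm_inv mulrC ler_pdivrMr// mul1r.
Qed.

End hilbert_spaces.

(** * Contractive forms and contractions *)

Section contraction_of_form.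
Variables (R : realType) (E : lmodType R[i]) (s : semi_inner E).
Variable k : E -> E -> R[i].
Hypothesis k_linear : forall a f g h, k (a *: f + g) h = a * k f h + k g h.
Hypothesis k_conj_linear : forall f, conj_linear (k f).
Hypothesis k_bound : forall f g, nrm (k f g) <= ssnorm s f * ssnorm s g.

Lemma transposed_bounded g :
  (fun f => Num.conj (k f g)) \in bounded_conj_linear s.
Proof.
apply/asboolP; split=> [a f h|]; first by rewrite k_linear rmorphD rmorphM.
exists (ssnorm s g); split=> [|f]; first exact: ssnorm_ge0.
by rewrite nrm_conj mulrC.
Qed.

(** [W g] represents k(., g): the reproducing property gives
    <embed f, W g> = k(f, g). *)
Let W g : completion s := Completion (transposed_bounded g).

Lemma transposed_nrm g : nrm (W g) <= ssnorm s g.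
Proof.
apply: nrm_functional_bound; split=> [|f]; first exact: ssnorm_ge0.
by rewrite /= nrm_conj mulrC.
Qed.

Lemma pulled_back_bound (phi : completion s) :
  functional_bound s (fun g => inner phi (W g)) (nrm phi).
Proof.
split=> [|g]; first exact: nrm_ge0.
apply: le_trans (inner_CauchySchwarz _ _) _.
by rewrite ler_wpM2l ?nrm_ge0// transposed_nrm.
Qed.

Lemma pulled_back_bounded (phi : completion s) :
  (fun g => inner phi (W g)) \in bounded_conj_linear s.
Proof.
apply/asboolP; split; last by exists (nrm phi); exact: pulled_back_bound.
move=> a f g; rewrite -inner_conj_linear; congr (inner phi _).
by apply: completion_ext => h /=; rewrite k_conj_linear rmorphD rmorphM/= conjCK.
Qed.

(** U phi is the functional g |-> <phi, W g>. It is defined at once on the whole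
    completion, so that no extension by continuity is needed, and its bound is
    that of [W]. *)
Lemma contraction_of_form : exists U : bounded_op (completion s) (completion s),
  (forall phi, nrm (U phi) <= nrm phi) /\
  forall f g, inner (U (embed s f)) (embed s g) = k f g.
Proof.
pose U0 phi : completion s := Completion (pulled_back_bounded phi).
have U0_nrm phi : nrm (U0 phi) <= nrm phi.
  by apply: nrm_functional_bound; exact: pulled_back_bound.
have U0_linear : linear U0.
  by move=> a phi psi; apply: completion_ext => g; exact: inner_linear.
have [||U UE] := @bounded_op_exists _ _ _ U0 1 => //.
  by move=> phi; rewrite mul1r.
exists U; split=> [phi|f g]; first by rewrite UE.
by rewrite UE inner_embed /= inner_herm inner_embed /= conjCK.
Qed.

End contraction_of_form.

(** * Finitely supported functions and forms of kernels *)

Section finite_support.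
Variables (R : realType) (X : Type) (H : hilbertType R).
Local Notation C := R[i].

Definition finite_support_pred : {pred {classic X} -> H} :=
  [pred f : {classic X} -> H | `[< finite_set [set x | f x != 0] >]].

Lemma finite_support_submod : submod_closed finite_support_pred.
Proof.
split.
  apply/asboolP; rewrite (_ : [set _ | _] = set0) //.
  by apply/seteqP; split=> x //= /eqP[].
move=> a f g /asboolP ff /asboolP fg; apply/asboolP.
have ffg : finite_set ([set x | f x != 0] `|` [set x | g x != 0]).
  by rewrite finite_setU.
apply: sub_finite_set ffg => x /=.
have -> : (a *: f + g) x = a *: f x + g x by [].
have [->|fx _] := eqVneq (f x) 0; last by left.
by rewrite scaler0 add0r; right.
Qed.

HB.instance Definition _ := GRing.isSubmodClosed.Build C ({classic X} -> H)
  finite_support_pred finite_support_submod.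

Record finsupp := Finsupp {
  finsupp_fun :> {classic X} -> H;
  finsuppP : finsupp_fun \in finite_support_pred }.

HB.instance Definition _ := [isSub for finsupp_fun].
HB.instance Definition _ := [Choice of finsupp by <:].
HB.instance Definition _ := [SubChoice_isSubLmodule of finsupp by <:].

Lemma finsupp_finite (f : finsupp) : finite_set [set x | f x != 0].
Proof. exact/asboolP/finsuppP. Qed.

Lemma finsupp_ext (f g : finsupp) : f =1 g -> f = g.
Proof. by move=> fg; apply/val_inj/funext. Qed.

Lemma finsuppE a (f g : finsupp) x : (a *: f + g) x = a *: f x + g x.
Proof. by []. Qed.

Lemma single_finite (x : {classic X}) h :
  (fun y => if y == x then h else 0) \in finite_support_pred.
Proof.
apply/asboolP; apply: (@sub_finite_set _ _ [set x]); last exact: finite_set1.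
by move=> y /=; case: ifPn => [/eqP//|_]; rewrite eqxx.
Qed.

Definition single (x : {classic X}) (h : H) : finsupp := Finsupp (single_finite x h).

Lemma single_linear x : linear (single x).
Proof.
move=> a h g; apply: finsupp_ext => y; rewrite finsuppE/=.
by case: eqP => // _; rewrite scaler0 addr0.
Qed.

(** Sums over [X] are computed over duplicate-free sequences that carry all the
    functions involved, which need not be the exact supports. *)
Definition carried (r : seq {classic X}) (f : finsupp) :=
  forall x, x \notin r -> f x = 0.

Lemma common_support (fs : seq finsupp) :
  exists2 r, uniq r & forall f, f \in fs -> carried r f.
Proof.
elim: fs => [|f fs [r ur fsr]]; first by exists [::].
have /finite_seqP[q qE] := finsupp_finite f.
exists (undup (q ++ r)); first exact: undup_uniq.
move=> g; rewrite in_cons => /predU1P[->|gfs] x; rewrite mem_undup mem_cat.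
  rewrite negb_or => /andP[xq _]; apply: contraNeq xq => fx.
  by have : [set x | f x != 0] x by []; rewrite qE.
by rewrite negb_or => /andP[_ xr]; exact: fsr xr.
Qed.

Lemma finsupp_sum (f : finsupp) r : uniq r -> carried r f ->
  f = \sum_(x <- r) single x (f x).
Proof.
move=> ur fr; apply: finsupp_ext => z.
rewrite (big_morph (fun g : finsupp => g z) (id1 := 0) (op1 := +%R))//=.
have [zr|zr] := boolP (z \in r).
  rewrite (bigD1_seq z)//= eqxx big1 ?addr0// => x /negbTE xz.
  by rewrite eq_sym xz.
rewrite fr// big_seq big1// => x xr; case: eqP => // zx.
by rewrite -zx (negbTE zr) in xr.
Qed.

Lemma fsum_fsumE (F : {classic X} -> {classic X} -> C) r : uniq r ->
  (forall x y, (x \notin r) || (y \notin r) -> F x y = 0) ->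
  \sum_(x \in [set: {classic X}]) \sum_(y \in [set: {classic X}]) F x y =
  \sum_(x <- r) \sum_(y <- r) F x y.
Proof.
move=> ur F0.
have sum_r (G : {classic X} -> C) : (forall x, x \notin r -> G x = 0) ->
    \sum_(x \in [set: {classic X}]) G x = \sum_(x <- r) G x.
  move=> G0; rewrite [RHS]fsbig_seq//; symmetry.
  apply: (fsbig_widen [set` r] [set: {classic X}] G) => // x [_ /= /negP xr].
  exact: G0.
rewrite sum_r => [|x xr]; last first.
  by apply: fsbig1 => y _; rewrite F0// xr.
by apply: eq_bigr => x _; apply: sum_r => y yr; rewrite F0// yr orbT.
Qed.

End finite_support.

Section kernel_form.
Variables (R : realType) (X : Type) (H : hilbertType R).
Local Notation C := R[i].
Implicit Types (A : kernel X H) (f g : finsupp X H).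

Definition kernel_form A f g : C :=
  \sum_(x \in [set: {classic X}]) \sum_(y \in [set: {classic X}])
    inner (A x y (f y)) (g x).

Lemma kernel_formE A f g r : uniq r -> carried r f -> carried r g ->
  kernel_form A f g = \sum_(x <- r) \sum_(y <- r) inner (A x y (f y)) (g x).
Proof.
move=> ur fr gr; apply: fsum_fsumE => // x y /orP[xr|yr].
  by rewrite (gr x xr) linear0r.
by rewrite (fr y yr) linear0 linear0l.
Qed.

Lemma kernel_form_linear A a f g h :
  kernel_form A (a *: f + g) h = a * kernel_form A f h + kernel_form A g h.
Proof.
have [r ur rP] := common_support [:: a *: f + g; f; g; h].
rewrite !(kernel_formE _ ur); try by apply: rP; rewrite !inE eqxx ?orbT.
rewrite mulr_sumr -big_split; apply: eq_bigr => x _ /=.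
rewrite mulr_sumr -big_split; apply: eq_bigr => y _ /=.
transitivity (inner (A x y (a *: f y + g y)) (h x)) => //.
by rewrite linearP inner_linear.
Qed.

Lemma kernel_form_adjoint A f g :
  kernel_form (adjoint_kernel A) f g = Num.conj (kernel_form A g f).
Proof.
have [r ur rP] := common_support [:: f; g].
rewrite !(kernel_formE _ ur); try by apply: rP; rewrite !inE eqxx ?orbT.
rewrite exchange_big rmorph_sum; apply: eq_bigr => x _ /=.
rewrite rmorph_sum; apply: eq_bigr => y _ /=.
by rewrite inner_adjoint -inner_herm.
Qed.

Lemma kernel_form_herm A f g : hermitian_kernel A ->
  kernel_form A f g = Num.conj (kernel_form A g f).
Proof.
move=> hA; rewrite -kernel_form_adjoint.
have [r ur rP] := common_support [:: f; g].
rewrite !(kernel_formE _ ur); try by apply: rP; rewrite !inE eqxx ?orbT.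
by apply: eq_bigr => x _; apply: eq_bigr => y _; rewrite hA.
Qed.

Lemma kernel_form_conj_linear A f : conj_linear (kernel_form A f).
Proof.
move=> a g h; rewrite -[LHS]conjCK -kernel_form_adjoint kernel_form_linear.
by rewrite rmorphD rmorphM/= !kernel_form_adjoint !conjCK.
Qed.

Lemma kernel_formZl A a f g : kernel_form A (a *: f) g = a * kernel_form A f g.
Proof.
have A0 : kernel_form A 0 g = 0.
  have := kernel_form_linear A (-1) 0 0 g.
  by rewrite scaler0 addr0 mulN1r addNr.
by rewrite -[a *: f]addr0 kernel_form_linear A0 addr0.
Qed.

Lemma kernel_formZr A a f g :
  kernel_form A f (a *: g) = Num.conj a * kernel_form A f g.
Proof. exact: conj_linearZ (kernel_form_conj_linear A f). Qed.

Lemma kernel_form_single A x y h k :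
  kernel_form A (single y h) (single x k) = inner (A x y h) k.
Proof.
have [r ur rE] : exists2 r : seq {classic X}, uniq r & r =i [:: x; y].
  by exists (undup [:: x; y]); [exact: undup_uniq|exact: mem_undup].
have carried_single (z : {classic X}) (l : H) : z \in r -> carried r (single z l).
  by move=> zr w wr /=; case: eqP => // wz; rewrite wz zr in wr.
have xr : x \in r by rewrite rE inE eqxx.
have yr : y \in r by rewrite rE !inE eqxx orbT.
rewrite (kernel_formE _ ur); [|exact: carried_single..].
rewrite (bigD1_seq x)//= [X in _ + X]big1 ?addr0 => [|z /negbTE zx]; last first.
  by rewrite big1// => w _; rewrite zx linear0r.
rewrite (bigD1_seq y)//= big1 ?addr0 ?eqxx// => z /negbTE zy.
by rewrite zy linear0 linear0l.
Qed.

Lemma kernel_form_ge0 A f : positive_definite A -> 0 <= kernel_form A f f.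
Proof. by move=> [_ A0]; apply: A0; exact: finsupp_finite. Qed.

End kernel_form.

Section block_form.
Variables (R : realType) (X : Type) (H : hilbertType R).
Implicit Types f g : finsupp X H.

Lemma pair_finite f g :
  (fun x => (f x, g x) : dsum H H) \in @finite_support_pred R X (dsum H H).
Proof.
have [r _ rP] := common_support [:: f; g].
apply/asboolP/(@sub_finite_set _ _ [set` r]); last exact: finite_seq.
move=> x /=; apply: contraNT => xr.
by rewrite (rP f) ?(rP g)// !inE eqxx ?orbT.
Qed.

Definition pair_finsupp f g : finsupp X (dsum H H) := Finsupp (pair_finite f g).

Lemma kernel_form_block (L1 K K' L2 : kernel X H) f g :
  kernel_form (block_kernel L1 K K' L2) (pair_finsupp f g) (pair_finsupp f g) =
  kernel_form L1 f f + kernel_form K g f + (kernel_form K' f g + kernel_form L2 g g).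
Proof.
have [r ur rP] := common_support [:: f; g].
have fr : carried r f by apply: rP; rewrite inE eqxx.
have gr : carried r g by apply: rP; rewrite !inE eqxx orbT.
have fgr : carried r (pair_finsupp f g) by move=> x xr /=; rewrite fr// gr.
rewrite (kernel_formE _ ur fgr fgr) !(kernel_formE _ ur)//.
rewrite -!big_split; apply: eq_bigr => x _ /=.
rewrite -!big_split; apply: eq_bigr => y _ /=.
by rewrite -!linearDl.
Qed.

End block_form.

(** * Decomposable kernels factor through a contraction *)

Section necessity.
Variables (R : realType) (X : Type) (H : hilbertType R) (K L1 L2 : kernel X H).
Hypothesis L1_pos : positive_definite L1.
Hypothesis L2_pos : positive_definite L2.
Hypothesis block_pos : positive_definite (block_kernel L1 K (adjoint_kernel K) L2).
Local Notation E := (finsupp X H).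
Implicit Types f g : E.

(** The block kernel is nonnegative at the pair (- t k(f, g) g, f) for every real
    t; the result is a quadratic polynomial in t, and its discriminant is the
    claim. *)
Lemma block_CauchySchwarz f g :
  nrm (kernel_form K f g) ^+ 2 <=
    complex.Re (kernel_form L2 f f) * complex.Re (kernel_form L1 g g).
Proof.
have L1g := kernel_form_ge0 g L1_pos; have L2f := kernel_form_ge0 f L2_pos.
apply: discriminant; rewrite ?Re_ge0// => t.
set c := kernel_form K f g; pose z := - (t%:C * c).
have := Re_ge0 (kernel_form_ge0 (pair_finsupp (z *: g) f) block_pos).
rewrite kernel_form_block kernel_form_adjoint.
rewrite !(kernel_formZl, kernel_formZr) -/c.
move: (ge0_ReE L1g) (ge0_ReE L2f).
move: (complex.Re (kernel_form L1 g g)) (complex.Re (kernel_form L2 f f)).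
move=> b a -> ->.
have zc : Num.conj z * c = (- (t * nrm c ^+ 2))%:C.
  rewrite /z rmorphN rmorphM/= conj_real mulNr -mulrA [_ * c]mulrC mul_conj.
  by rewrite -rmorphM -rmorphN.
have zz : Num.conj z * z = (t ^+ 2 * nrm c ^+ 2)%:C.
  rewrite {2}/z mulrN mulrCA zc -rmorphM -rmorphN; congr (_%:C); ring.
rewrite mulrA [z * _]mulrC zz zc conj_real -!rmorphM -!rmorphD/=; lra.
Qed.

Lemma sum_form_linear a f g h :
  kernel_form L1 (a *: f + g) h + kernel_form L2 (a *: f + g) h =
  a * (kernel_form L1 f h + kernel_form L2 f h)
    + (kernel_form L1 g h + kernel_form L2 g h).
Proof. by rewrite !kernel_form_linear mulrDr addrACA. Qed.

Lemma sum_form_herm f g : kernel_form L1 f g + kernel_form L2 f g =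
  Num.conj (kernel_form L1 g f + kernel_form L2 g f).
Proof.
by rewrite rmorphD/= -!kernel_form_herm//; [case: L2_pos|case: L1_pos].
Qed.

Lemma sum_form_ge0 f : 0 <= kernel_form L1 f f + kernel_form L2 f f.
Proof. by rewrite addr_ge0// kernel_form_ge0. Qed.

Definition sum_form : semi_inner E :=
  SemiInner sum_form_linear sum_form_herm sum_form_ge0.

Let KK : hilbertType R := completion sum_form.

Lemma single_bounded x : exists M : R, forall h,
  nrm (embed sum_form (single x h)) <= M * nrm h.
Proof.
have [M1 M10 L1M] := bounded_opP (L1 x x); have [M2 M20 L2M] := bounded_opP (L2 x x).
have M0 : 0 <= M1 + M2 + 1 by rewrite !addr_ge0.
(* [M1 + M2] bounds the square of the norm, and a <= (a + 1)^2 for a >= 0 *)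
exists (M1 + M2 + 1) => h.
rewrite nrm_embed -ler_sqr ?nnegrE ?ssnorm_ge0 ?mulr_ge0 ?nrm_ge0//.
rewrite ssnorm_sqr /= !kernel_form_single ReD.
have bound (T : bounded_op H H) M : (forall k, nrm (T k) <= M * nrm k) ->
    complex.Re (inner (T h) h) <= M * nrm h ^+ 2.
  move=> TM; apply: le_trans (Re_le_nrm _) _.
  apply: le_trans (inner_CauchySchwarz _ _) _.
  by rewrite expr2 mulrA ler_wpM2r ?nrm_ge0.
apply: le_trans (lerD (bound _ _ L1M) (bound _ _ L2M)) _.
by rewrite -mulrDl exprMn ler_wpM2r ?sqr_ge0//; nra.
Qed.

Lemma embed_single_linear x : linear (fun h => embed sum_form (single x h) : KK).
Proof. by move=> a h k; rewrite single_linear embed_linear. Qed.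

(** The adjoint of V(x) applied to U V(y) h is determined by its inner products
    with vectors k, which are the values of the form of [K] at functions
    supported at a point. Totality holds because every finitely supported
    function is the sum of such functions and embedded functions are dense. *)
Lemma decomposable_factorization :
  exists (KK : hilbertType R) (V : X -> bounded_op H KK) (U : bounded_op KK KK),
    [/\ contraction_op U,
        forall x y, K x y =1 adjoint (V x) \o U \o V y &
        total_set [set V x h | x in [set: X] & h in [set: H]] ].
Proof.
have K_bound f g :
    nrm (kernel_form K f g) <= ssnorm sum_form f * ssnorm sum_form g.
  rewrite -ler_sqr ?nnegrE ?mulr_ge0 ?nrm_ge0 ?ssnorm_ge0//.
  apply: le_trans (block_CauchySchwarz f g) _.
  rewrite exprMn !ssnorm_sqr /= !ReD.
  have := Re_ge0 (kernel_form_ge0 g L1_pos); have := Re_ge0 (kernel_form_ge0 g L2_pos).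
  have := Re_ge0 (kernel_form_ge0 f L1_pos); have := Re_ge0 (kernel_form_ge0 f L2_pos).
  by move=> *; rewrite ler_pM// ?lerDl ?lerDr.
have [U [U1 UE]] := contraction_of_form (kernel_form_linear K)
  (kernel_form_conj_linear K) K_bound.
have /choice[V VE] (x : X) : exists T : bounded_op H KK,
    forall h, T h = embed sum_form (single (x : {classic X}) h).
  have [M VM] := single_bounded x.
  exact: bounded_op_exists (embed_single_linear x) VM.
exists KK, V, U; split; first exact/contraction_opP.
  move=> x y h; apply: inner_ext => k.
  by rewrite /= inner_adjoint !VE UE kernel_form_single.
move=> O [phi Ophi] oO.
have /nbhs_ballP[e /= e0 eO] : nbhs phi O by apply: open_nbhs_nbhs; split.
have er : 0 < complex.Re e / 2 by rewrite divr_gt0//; move: e0; rewrite ltcE => /andP[].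
have [f fphi] := embed_dense phi er.
exists (embed sum_form f); split.
  apply: eO; rewrite -ball_normE/= nrmE -(RRe_real (gtr0_real e0)) ltcR.
  by apply: le_lt_trans fphi _; lra.
have [r ur rP] := common_support [:: f].
exists (size r), (fun=> 1), (fun i => V (tnth (in_tuple r) i) (f (tnth (in_tuple r) i))).
split; first by move=> i; eexists => //; eexists.
rewrite {1}(finsupp_sum ur (rP f _)) ?inE// embed_sum big_tnth.
by apply: eq_bigr => i _; rewrite scale1r VE.
Qed.

End necessity.

(** * Factorizations give decompositions *)

Section sufficiency.
Variables (R : realType) (X : Type) (H KK : hilbertType R).
Variables (V : X -> bounded_op H KK) (U : bounded_op KK KK).
Variable K : kernel X H.
Hypothesis U1 : contraction_op U.
Hypothesis KE : forall x y, K x y =1 adjoint (V x) \o U \o V y.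

(** Both diagonal blocks are L(x, y) = V(x)* V(y). *)
Lemma factorization_decomposable : decomposable K.
Proof.
have /choice[L0 L0E] (p : X * X) := comp_op_exists (adjoint (V p.1)) (V p.2).
pose L : kernel X H := fun x y => L0 (x, y).
have LE x y h k : inner (L x y h) k = inner (V y h) (V x k).
  by rewrite /L L0E /= inner_adjoint.
have LEr x y h k : inner h (L x y k) = inner (V x h) (V y k).
  by rewrite inner_herm LE -inner_herm.
have KEl x y h k : inner (K x y h) k = inner (U (V y h)) (V x k).
  by rewrite KE /= inner_adjoint.
have KEr x y h k : inner h (K x y k) = inner (V x h) (U (V y k)).
  by rewrite inner_herm KEl -inner_herm.
have L_herm x y : adjoint (L y x) =1 L x y.
  by apply: adjoint_unique => h k; rewrite LE inner_herm -LE -inner_herm.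
have L_pos : positive_definite L.
  split=> // f0 ff0; pose f : finsupp X H := Finsupp (asboolT ff0).
  have [r ur rP] := common_support [:: f].
  have fr : carried r f by apply: rP; rewrite inE.
  rewrite -[X in 0 <= X]/(kernel_form L f f) (kernel_formE _ ur fr fr).
  have -> : \sum_(x <- r) \sum_(y <- r) inner (L x y (f y)) (f x) =
      inner (\sum_(x <- r) V x (f x)) (\sum_(x <- r) V x (f x)).
    by rewrite inner_sum; under eq_bigr do under eq_bigr do rewrite LE.
  exact: dnorm_ge0.
exists L, L; split=> //; split.
  move=> x y; apply: adjoint_unique => -[h1 h2] [k1 k2].
  change (inner (L y x h1 + K y x h2) k1 + inner (adjoint (K x y) h1 + L y x h2) k2 =
    inner h1 (L x y k1 + K x y k2) + inner h2 (adjoint (K y x) k1 + L x y k2)).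
  rewrite !linearDl/= !linearDr/= inner_adjoint !LE !LEr -adjointP; ring.
move=> f0 ff0; pose f : finsupp X (dsum H H) := Finsupp (asboolT ff0).
have [r ur rP] := common_support [:: f].
have fr : carried r f by apply: rP; rewrite inE.
rewrite -[X in 0 <= X]/(kernel_form _ f f) (kernel_formE _ ur fr fr).
pose a := \sum_(x <- r) V x (f x).1; pose b := \sum_(x <- r) V x (f x).2.
have -> : \sum_(x <- r) \sum_(y <- r)
      inner (block_kernel L K (adjoint_kernel K) L x y (f y)) (f x) =
    inner a a + inner (U b) a + (inner a (U b) + inner b b).
  have -> : U b = \sum_(x <- r) U (V x (f x).2) by rewrite linear_sum.
  rewrite !inner_sum -!big_split; apply: eq_bigr => x _ /=.
  rewrite -!big_split; apply: eq_bigr => y _ /=.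
  change (inner (L x y (f y).1 + K x y (f y).2) (f x).1 +
    inner (adjoint (K y x) (f y).1 + L x y (f y).2) (f x).2 =
    inner (V y (f y).1) (V x (f x).1) + inner (U (V y (f y).2)) (V x (f x).1) +
    (inner (V y (f y).1) (U (V x (f x).2)) + inner (V y (f y).2) (V x (f x).2))).
  by rewrite !linearDl/= !LE KEl inner_adjoint KEr.
(* completing the square leaves the defect |b|^2 - |U b|^2 of the contraction *)
have -> : inner a a + inner (U b) a + (inner a (U b) + inner b b) =
    inner (a + U b) (a + U b) + (inner b b - inner (U b) (U b)).
  by rewrite linearDl/= !linearDr/=; ring.
rewrite addr_ge0 ?dnorm_ge0// !inner_nrm -rmorphB ler0c subr_ge0.
by rewrite ler_sqr ?nnegrE ?nrm_ge0//; exact: (contraction_opP U).1 U1 b.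
Qed.

End sufficiency.

Theorem theorem4p4 (R : realType) (X : Type) (H : hilbertType R)
    (K : kernel X H) :
  decomposable K <->
  exists (KK : hilbertType R) (V : X -> bounded_op H KK)
         (U : bounded_op KK KK),
    [/\ contraction_op U,
        forall x y, K x y =1 adjoint (V x) \o U \o V y &
        total_set [set V x h | x in [set: X] & h in [set: H]] ].
Proof.
split=> [[L1 [L2 [L1_pos L2_pos block_pos]]]|[KK [V [U [U1 KE _]]]]].
  exact: decomposable_factorization L1_pos L2_pos block_pos.
exact: factorization_decomposable U1 KE.
Qed.
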